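(* Let $\boldsymbol{p}=(p_n)_{n\ge1}$ be a sequence of monomials $p_n(z)=a_n z^{d_n}$ with $a_n\in\mathbb{C}\setminus\{0\}$ and integers $d_n\ge1$ for all $n\in\mathbb{N}$, and assume that $d_n\ge2$ for infinitely many $n$. Denote $F^{(n)}_{\boldsymbol{p}}=p_n\circ\dots\circ p_1$, and let $\mathscr{J}^{\mathrm{aut}}\big(F^{(n)}_{\boldsymbol{p}}\big)$ be the autonomous Julia set of the function $F^{(n)}_{\boldsymbol{p}}$. Then $$\mathscr{J}(\boldsymbol{p})=\limsup_{n\to+\infty}\mathscr{J}^{\mathrm{aut}}\big(F^{(n)}_{\boldsymbol{p}}\big)=\bigcap_{N\ge1}\overline{\bigcup_{n\ge N}\mathscr{J}^{\mathrm{aut}}\big(F^{(n)}_{\boldsymbol{p}}\big)},$$ where the Kuratowski limit superior and the closure are taken in the metric space $(\hat{\mathbb{C}},\sigma)$.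
   Context: $\hat{\mathbb{C}}=\mathbb{C}\cup\{\infty\}$ is the Riemann sphere with the spherical metric $\sigma$. For a sequence $\boldsymbol{f}=(f_n)_{n\ge1}$ of rational maps of $\hat{\mathbb{C}}$, put $F^{(n)}_{\boldsymbol{f}}:=f_n\circ\dots\circ f_1$. The Fatou set $\mathscr{F}(\boldsymbol{f})$ is the largest open subset of $\hat{\mathbb{C}}$ on which the family $\{F^{(n)}_{\boldsymbol{f}} : n\ge1\}$ is normal (every sequence in the family has a subsequence converging locally uniformly, with respect to $\sigma$, to a holomorphic map into $\hat{\mathbb{C}}$), and the Julia set is $\mathscr{J}(\boldsymbol{f}):=\hat{\mathbb{C}}\setminus\mathscr{F}(\boldsymbol{f})$. The autonomous Julia set $\mathscr{J}^{\mathrm{aut}}(g)$ of a single rational map $g$ is the complement of the largest open set on which the family of iterates $\{g^{\circ k}: k\ge1\}$ is normal. For subsets $E_n$ of a metric space $(X,d)$, the Kuratowski limit superior is $\limsup_{n\to+\infty}E_n=\{x\in X : \liminf_{n\to+\infty}\operatorname{dist}_d(x,E_n)=0\}$. *)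

(* Defs.v *)
From HB Require Import structures.
From mathcomp Require Import all_boot all_order all_algebra.
From mathcomp Require Import complex ring lra.
From mathcomp Require Import all_classical all_reals all_analysis.

Set Implicit Arguments.
Unset Strict Implicit.
Unset Printing Implicit Defensive.

Import Order.TTheory GRing.Theory Num.Theory.
Import numFieldNormedType.Exports.

Local Open Scope classical_set_scope.
Local Open Scope ring_scope.

(* [Some z] is the finite point z and [None] is the point at infinity. *)
Definition riemann_sphere (R : realType) : Type := option R[i].

HB.instance Definition _ (R : realType) :=
  Choice.copy (riemann_sphere R) (option R[i]).

Section SphericalMetric.
Variable R : realType.
Implicit Types (x y z : riemann_sphere R) (u v w : R * R * R).

(* Inverse stereographic projection onto the unit sphere of R^3, with infinity
   sent to the north pole. *)
Definition stereo x : R * R * R :=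
  match x with
  | Some (a +i* b)%C =>
      let s := a ^+ 2 + b ^+ 2 in
      (2 * a / (s + 1), 2 * b / (s + 1), (s - 1) / (s + 1))
  | None => (0, 0, 1)
  end.

Definition dot3 u v : R := u.1.1 * v.1.1 + u.1.2 * v.1.2 + u.2 * v.2.

(* Great-circle distance, i.e. the geodesic distance of 2|dz|/(1+|z|^2). *)
Definition spherical_dist x y : R := acos (dot3 (stereo x) (stereo y)).

Lemma stereo_unit x : dot3 (stereo x) (stereo x) = 1.
Proof.
case: x => [[a b]|]; rewrite /dot3 /=; last by ring.
have : a ^+ 2 + b ^+ 2 + 1 != 0.
  by rewrite gt_eqF// ltr_wpDl// addr_ge0// sqr_ge0.
by move=> h; field.
Qed.

Lemma dot3C u v : dot3 u v = dot3 v u.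
Proof. by rewrite /dot3; ring. Qed.

Lemma dot3_bound u v : dot3 u u = 1 -> dot3 v v = 1 ->
  -1 <= dot3 u v <= 1.
Proof.
case: u => [[a b] c]; case: v => [[a' b'] c']; rewrite /dot3 /= => hu hv.
have := sqr_ge0 (a - a'); have := sqr_ge0 (b - b'); have := sqr_ge0 (c - c').
have := sqr_ge0 (a + a'); have := sqr_ge0 (b + b'); have := sqr_ge0 (c + c').
rewrite !expr2 => *; apply/andP; split; lra.
Qed.

Lemma dot3_eq1 u v : dot3 u u = 1 -> dot3 v v = 1 -> dot3 u v = 1 -> u = v.
Proof.
case: u => [[a b] c]; case: v => [[a' b'] c']; rewrite /dot3 /= => hu hv huv.
have h : (a - a') ^+ 2 + (b - b') ^+ 2 + (c - c') ^+ 2 = 0.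
  rewrite !expr2; lra.
have ha := sqr_ge0 (a - a'); have hb := sqr_ge0 (b - b').
have hc := sqr_ge0 (c - c').
have /eqP : (a - a') ^+ 2 = 0 by lra.
have /eqP : (b - b') ^+ 2 = 0 by lra.
have /eqP : (c - c') ^+ 2 = 0 by lra.
by rewrite !sqrf_eq0 !subr_eq0 => /eqP -> /eqP -> /eqP ->.
Qed.

Lemma stereo_inj : injective stereo.
Proof.
have pos (a b : R) : 0 < a ^+ 2 + b ^+ 2 + 1.
  by rewrite ltr_wpDl// addr_ge0// sqr_ge0.
have no (a b : R) : stereo (Some (a +i* b)%C) <> (0, 0, 1).
  move=> [_ _] /(congr1 ( *%R^~ (a ^+ 2 + b ^+ 2 + 1))).
  by rewrite divfK ?gt_eqF ?pos// => h; lra.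
case=> [[a b]|] [[a' b']|] //; [|by move=> /no|by move=> /esym/no].
have p := pos a b; have p' := pos a' b'.
move=> /= [h1 h2 h3].
have e : a ^+ 2 + b ^+ 2 + 1 = a' ^+ 2 + b' ^+ 2 + 1.
  have q t : 0 < t + 1 -> (t - 1) / (t + 1) = 1 - 2 / (t + 1) :> R.
    by move=> t0; field; rewrite gt_eqF.
  move: h3; rewrite !q// => h3.
  have /invr_inj : (a ^+ 2 + b ^+ 2 + 1)^-1 = (a' ^+ 2 + b' ^+ 2 + 1)^-1 by lra.
  by [].
have n : (a' ^+ 2 + b' ^+ 2 + 1)^-1 != 0 by rewrite invr_eq0 gt_eqF.
move: h1 h2; rewrite e => /(mulIf n) h1 /(mulIf n) h2.
by congr (Some (_ +i* _)%C); lra.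
Qed.

Lemma dot3_gram u v w : dot3 u u = 1 -> dot3 v v = 1 -> dot3 w w = 1 ->
  (dot3 u w - dot3 u v * dot3 v w) ^+ 2 <=
  (1 - dot3 u v ^+ 2) * (1 - dot3 v w ^+ 2).
Proof.
case: u => [[a b] c]; case: v => [[a' b'] c']; case: w => [[a2 b2] c2].
move=> hu hv hw; rewrite -subr_ge0.
set D := a * (b' * c2 - c' * b2) - b * (a' * c2 - c' * a2)
         + c * (a' * b2 - b' * a2).
suff -> : (1 - dot3 (a, b, c) (a', b', c') ^+ 2) *
    (1 - dot3 (a', b', c') (a2, b2, c2) ^+ 2) -
    (dot3 (a, b, c) (a2, b2, c2) -
     dot3 (a, b, c) (a', b', c') * dot3 (a', b', c') (a2, b2, c2)) ^+ 2
    = D ^+ 2 by exact: sqr_ge0.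
have -> : D ^+ 2 = dot3 (a, b, c) (a, b, c) * dot3 (a', b', c') (a', b', c')
     * dot3 (a2, b2, c2) (a2, b2, c2)
   + 2 * dot3 (a, b, c) (a', b', c') * dot3 (a', b', c') (a2, b2, c2)
     * dot3 (a, b, c) (a2, b2, c2)
   - dot3 (a, b, c) (a, b, c) * dot3 (a', b', c') (a2, b2, c2) ^+ 2
   - dot3 (a', b', c') (a', b', c') * dot3 (a, b, c) (a2, b2, c2) ^+ 2
   - dot3 (a2, b2, c2) (a2, b2, c2) * dot3 (a, b, c) (a', b', c') ^+ 2.
  by rewrite /D /dot3 /=; ring.
by rewrite hu hv hw; ring.
Qed.

Lemma stereo_bound x y : -1 <= dot3 (stereo x) (stereo y) <= 1.
Proof. by apply: dot3_bound; exact: stereo_unit. Qed.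

Lemma spherical_distxx x : spherical_dist x x = 0.
Proof. by rewrite /spherical_dist stereo_unit acos1. Qed.

Lemma spherical_dist_positivity x y : spherical_dist x y = 0 -> x = y.
Proof.
rewrite /spherical_dist => h; apply: stereo_inj.
apply: dot3_eq1; rewrite ?stereo_unit//.
by rewrite -[LHS]acosK ?in_itv /= ?stereo_bound// h cos0.
Qed.

Lemma spherical_dist_sym x y : spherical_dist x y = spherical_dist y x.
Proof. by rewrite /spherical_dist dot3C. Qed.

Lemma spherical_dist_triangle y x z :
  spherical_dist x z <= spherical_dist x y + spherical_dist y z.
Proof.
rewrite /spherical_dist.
have bxy := stereo_bound x y; have byz := stereo_bound y z.
have bxz := stereo_bound x z.
set s := acos (dot3 (stereo x) (stereo y)) + acos (dot3 (stereo y) (stereo z)).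
have s0 : 0 <= s by rewrite addr_ge0// acos_ge0.
have [spi|/ltW spi] := leP s pi; last exact: le_trans (acos_lepi bxz) spi.
have Hle : cos s <= dot3 (stereo x) (stereo z).
  rewrite cosD !acosK ?in_itv//= !sin_acos// -sqrtrM; last first.
    by move: bxy => /andP[? ?]; rewrite expr2; nra.
  rewrite lerBlDr -lerBlDl.
  have := dot3_gram (stereo_unit x) (stereo_unit y) (stereo_unit z).
  move=> /ler_wsqrtr; rewrite sqrtr_sqr; apply: le_trans.
  by rewrite -normrN opprB ler_norm.
rewrite leNgt; apply/negP => h.
have := @ltr_cos R s (acos (dot3 (stereo x) (stereo z))).
rewrite !in_itv /= s0 spi acos_ge0// acos_lepi// acosK ?in_itv//=.
by rewrite h ltNge Hle => /(_ isT isT).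
Qed.

HB.instance Definition _ := isMetric.Build R (riemann_sphere R)
  spherical_distxx spherical_dist_positivity spherical_dist_sym
  spherical_dist_triangle.

End SphericalMetric.

Section Holomorphic.
Variable R : realType.
Implicit Types (x : riemann_sphere R) (g : riemann_sphere R -> riemann_sphere R).

(* [chart false] is the coordinate z on the complement of infinity and
   [chart true] is the coordinate 1/z on the complement of 0, with value 0 at
   infinity. The values outside [chart_dom] are irrelevant. *)
Definition chart_dom (b : bool) : set (riemann_sphere R) :=
  if b then [set~ Some 0] else [set~ None].

Definition chart (b : bool) x : R[i] :=
  match x with
  | Some z => if b then z^-1 else z
  | None => 0
  end.

Definition chart_inv (b : bool) (z : R[i]) : riemann_sphere R :=
  if b then (if z == 0 then None else Some z^-1) else Some z.

(* [R[i]^o] is the complex line over the field R[i], so that [derivable _ _ 1]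
   is complex differentiability. *)
Definition holomorphic_at g x : Prop :=
  {for x, continuous g} /\
  forall b c : bool, chart_dom b x -> chart_dom c (g x) ->
    derivable (fun z : R[i]^o => chart c (g (chart_inv b z)) : R[i]^o)
      (chart b x) 1.

(* Only used for open U, where it depends only on the values of g on U. *)
Definition holomorphic_on (U : set (riemann_sphere R)) g : Prop :=
  forall x, U x -> holomorphic_at g x.

End Holomorphic.

Section Julia.
Variable R : realType.
Local Notation Chat := (riemann_sphere R).
Implicit Types (Fam : set (Chat -> Chat)) (U : set Chat).

Definition cvg_locally_uniformly U (u : nat -> Chat -> Chat) (g : Chat -> Chat)
  : Prop :=
  forall x, U x -> exists2 V : set Chat, nbhs x V & {uniform V, u @ \oo --> g}.

Definition normal_on Fam U : Prop :=
  forall u : nat -> Chat -> Chat, (forall k, Fam (u k)) ->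
  exists phi : nat -> nat, {homo phi : m n / (m < n)%N} /\
  exists g : Chat -> Chat,
    holomorphic_on U g /\ cvg_locally_uniformly U (u \o phi) g.

(* Normality is a local property, so the largest open set of normality is the
   union of all of them. *)
Definition fatou_family Fam : set Chat :=
  \bigcup_(U in [set U : set Chat | open U /\ normal_on Fam U]) U.

(* f_n o ... o f_1; the term f 0 is not used. *)
Fixpoint comp_seq (f : nat -> Chat -> Chat) (n : nat) : Chat -> Chat :=
  if n is m.+1 then f m.+1 \o comp_seq f m else id.

Definition fatou (f : nat -> Chat -> Chat) : set Chat :=
  fatou_family [set comp_seq f n | n in [set n | (1 <= n)%N]].

Definition julia (f : nat -> Chat -> Chat) : set Chat := ~` fatou f.

Definition julia_aut (g : Chat -> Chat) : set Chat :=
  ~` fatou_family [set iter k g | k in [set k | (1 <= k)%N]].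

(* z |-> a z^d for a != 0 and d >= 1, which fixes infinity. *)
Definition monomial (a : R[i]) (d : nat) : Chat -> Chat :=
  fun x => if x is Some z then Some (a * z ^+ d) else None.

End Julia.

(* [edist_inf] takes values in the extended reals and is +oo on the empty set,
   which makes empty terms E n harmless. *)
Definition kuratowski_limsup (R : realType) (X : metricType R)
  (E : nat -> set X) : set X :=
  [set x | limn_einf (fun n => edist_inf (E n) x) = 0%E].

(* Main.v *)
(* Write F_n(z) = A_n z^(D_n) and, for D_n >= 2, let r_n be the radius with
   |A_n| r_n^(D_n - 1) = 1. Then |F_n(z)| = |z| (|z| / r_n)^(D_n - 1), so on a set
   whose moduli stay away from the r_n every subsequence has a further one tending
   uniformly to 0 or to infinity, while near a point x such that the circles
   |z| = r_n accumulate at x, any limit of a suitable subsequence takes the value 0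
   at points of smaller modulus and infinity at points of larger modulus, hence is
   discontinuous. So the Julia set of the sequence is the limit set of these
   circles. All the iterates of F_n have the same radius r_n, so the same statement
   applied to the iterates shows that the autonomous Julia set of F_n is the circle
   |z| = r_n. The isometry z -> 1/z exchanges 0 and infinity. *)

Require Import Defs.
From HB Require Import structures.
From mathcomp Require Import all_boot all_order all_algebra.
From mathcomp Require Import complex ring lra.
From mathcomp Require Import all_classical all_reals all_analysis.

Set Implicit Arguments.
Unset Strict Implicit.
Unset Printing Implicit Defensive.

Import Order.TTheory GRing.Theory Num.Theory.
Import numFieldNormedType.Exports.
Import Normc.

Local Open Scope classical_set_scope.
Local Open Scope ring_scope.

(** * The real-valued modulus on the complex numbers *)

Section Modulus.
Variable R : realType.
Implicit Types z w : R[i].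

Lemma normc_ge0 z : 0 <= normc z.
Proof. by case: z => a b; rewrite sqrtr_ge0. Qed.

Lemma normc_sqr z : normc z ^+ 2 = complex.Re z ^+ 2 + complex.Im z ^+ 2.
Proof. by case: z => a b /=; rewrite sqr_sqrtr// addr_ge0// sqr_ge0. Qed.

Lemma normcX z n : normc (z ^+ n) = normc z ^+ n.
Proof.
by elim: n => [|n IH]; rewrite ?expr0 ?normc1// !exprS normcM IH.
Qed.

Lemma normc_eq0 z : (normc z == 0) = (z == 0).
Proof.
by apply/eqP/eqP => [/eq0_normc//|->]; rewrite normc0.
Qed.

Lemma normc_gt0 z : (0 < normc z) = (z != 0).
Proof. by rewrite lt_def normc_ge0 normc_eq0 andbT. Qed.

Lemma normc_real (t : R) : 0 <= t -> normc (t%:C)%C = t.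
Proof. by move=> t0; rewrite /= expr0n/= addr0 sqrtr_sqr ger0_norm. Qed.

Lemma normcB_le z w : normc w <= normc z + normc (w - z).
Proof. by have := le_normcD z (w - z); rewrite addrC subrK. Qed.

Lemma normc_distC z w : normc (z - w) = normc (w - z).
Proof. by rewrite -opprB; exact: (normcN (w - z)). Qed.

End Modulus.

(** * The spherical topology at finite points, and the inversion 1/z *)

Section Sphere.
Variable R : realType.
Local Notation Chat := (riemann_sphere R).
Implicit Types (x y : Chat) (z w : R[i]).

(** [1 - dot3] is half the squared chord between two points of the unit sphere. Unlike the arc
    length it is rational in the coordinates, so neighbourhoods can be estimated without [acos]. *)
Lemma chord_fin z w :
  1 - dot3 (stereo (Some z)) (stereo (Some w)) =
  2 * normc (z - w) ^+ 2 / ((1 + normc z ^+ 2) * (1 + normc w ^+ 2)).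
Proof.
rewrite !normc_sqr; case: z w => [a b] [c d] /=; rewrite /dot3/=.
have h (s t : R) : 1 + (s ^+ 2 + t ^+ 2) != 0.
  by rewrite gt_eqF// ltr_pwDl// addr_ge0// sqr_ge0.
have := h a b; have := h c d; rewrite ![1 + _]addrC => h1 h2.
by field; rewrite h1 h2.
Qed.

Lemma chord_infty z :
  1 - dot3 (stereo (Some z)) (stereo None) = 2 / (1 + normc z ^+ 2).
Proof.
rewrite !normc_sqr; case: z => [a b] /=; rewrite /dot3/=.
have : a ^+ 2 + b ^+ 2 + 1 != 0.
  by rewrite gt_eqF// ltr_wpDl// addr_ge0// sqr_ge0.
by move=> h; rewrite [in RHS]addrC; field.
Qed.

Lemma ball_sphereE x e y : ball x e y = (spherical_dist x y < e) :> Prop.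
Proof. by rewrite ballEmdist. Qed.

(** Together with [chord_lt], this makes smallness of the arc and smallness of [1 - dot3]
    interchangeable. *)
Lemma spherical_dist_lt (e : R) : 0 < e -> exists2 k : R, 0 < k &
  forall x y, 1 - dot3 (stereo x) (stereo y) < k -> spherical_dist x y < e.
Proof.
(* Cosine is strictly decreasing only on [0, pi]; when [e] exceeds pi, every pair of points is close
   enough. *)
move=> e0; have [ep|ep] := ltP pi e.
  exists 1 => // x y _; apply: le_lt_trans ep.
  by rewrite acos_lepi// stereo_bound.
exists (1 - cos e).
  rewrite subr_gt0 -[ltRHS](@cos0 R) ltr_cos ?in_itv/= ?lexx ?pi_ge0//.
  by rewrite (ltW e0).
move=> x y h; rewrite ltNge; apply/negP => h2.
have ei : e \in `[0, pi] by rewrite in_itv/= ep ltW.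
have di : spherical_dist x y \in `[0, pi].
  by rewrite in_itv/= acos_ge0 ?acos_lepi ?stereo_bound.
have : cos (spherical_dist x y) <= cos e by rewrite leNgt ltr_cos// -leNgt.
by rewrite /spherical_dist acosK ?in_itv/= ?stereo_bound//; lra.
Qed.

Lemma chord_lt (k : R) : 0 < k -> exists2 e : R, 0 < e &
  forall x y, spherical_dist x y < e -> 1 - dot3 (stereo x) (stereo y) < k.
Proof.
move=> k0; have /cvgrPdist_lt/(_ k k0) := @continuous_cos R 0.
move=> [e /= e0 he]; exists e => // x y h.
have d0 : 0 <= spherical_dist x y by rewrite acos_ge0 ?stereo_bound.
have := he (spherical_dist x y); rewrite /= sub0r normrN ger0_norm// => /(_ h).
rewrite cos0 /spherical_dist acosK ?in_itv/= ?stereo_bound//.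
exact/le_lt_trans/ler_norm.
Qed.

(** At a finite point the spherical neighbourhoods are the Euclidean ones; all later estimates are
    made with [normc] through this equivalence. *)
Lemma nbhs_Some z (V : set Chat) :
  nbhs (Some z : Chat) V <->
  exists2 c : R, 0 < c & forall w, normc (w - z) < c -> V (Some w).
Proof.
split.
  move=> /nbhs_ballP[e /= e0 he].
  have [k k0 hk] := spherical_dist_lt e0.
  (* With t = |w - z| < 1 and t < k/2, one gets 2 t^2 <= 2 t < k, and the denominator in [chord_fin]
     is at least 1. *)
  exists (Num.min 1 (k / 2)); first by rewrite lt_min ltr01 divr_gt0.
  move=> w; rewrite lt_min => /andP[h1 h2]; apply: he.
  rewrite ball_sphereE; apply: hk; rewrite chord_fin normc_distC.
  set t := normc (w - z) in h1 h2 *.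
  have t0 : 0 <= t := normc_ge0 _.
  have S1 u : 1 <= 1 + normc u ^+ 2 :> R by rewrite lerDl sqr_ge0.
  rewrite ltr_pdivrMr; last by rewrite mulr_gt0// (lt_le_trans ltr01).
  have {S1} := ler_pM ler01 ler01 (S1 z) (S1 w); rewrite mul1r.
  move: (_ * _) => P P1; nra.
move=> [c c0 hc].
(* With t = |w - z|, 1 + |z|^2 <= S and 1 + |w|^2 <= S + 2 t^2. A chord below k gives 2 t^2 < k S^2
   + 2 k S t^2. The two bounds in [k] make this less than c^2 + t^2, so t < c. The first bound also
   keeps infinity out of the ball. *)
set S := 1 + 2 * normc z ^+ 2.
have S1 : 1 <= S by rewrite /S; have := sqr_ge0 (normc z); lra.
pose k := Num.min (1 / (2 * S)) (c ^+ 2 / S ^+ 2).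
have k0 : 0 < k.
  by rewrite /k lt_min !divr_gt0 ?exprn_gt0 ?mulr_gt0//; lra.
have [e e0 he] := chord_lt k0.
apply/nbhs_ballP; exists e => // -[w|]; rewrite ball_sphereE => /he.
  rewrite chord_fin normc_distC => h; apply: hc.
  set t := normc (w - z) in h *.
  have wz : normc w <= normc z + t := normcB_le z w.
  have := normc_ge0 w; have := normc_ge0 z => z0 w0.
  have t0 : 0 <= t := normc_ge0 _.
  have [k1 k2] : k <= 1 / (2 * S) /\ k <= c ^+ 2 / S ^+ 2.
    by split; rewrite /k ge_min lexx ?orbT.
  have h1 : 2 * t ^+ 2 < k * (S * (S + 2 * t ^+ 2)).
    rewrite ltr_pdivrMr in h; last first.
      by rewrite mulr_gt0// ltr_pwDl// sqr_ge0.
    apply: lt_le_trans h _; rewrite ler_pM2l//.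
    apply: ler_pM; rewrite ?addr_ge0 ?sqr_ge0//.
      by rewrite lerD2l; have := sqr_ge0 (normc z); lra.
    have h2 : normc w ^+ 2 <= (normc z + t) ^+ 2.
      by rewrite ler_sqr ?nnegrE// addr_ge0.
    by rewrite /S; have := sqr_ge0 (normc z - t); lra.
  have h2 : k * S <= 1 / 2.
    by move: k1; rewrite ler_pdivlMr; [lra|rewrite mulr_gt0//; lra].
  have h3 : k * S ^+ 2 <= c ^+ 2.
    by move: k2; rewrite ler_pdivlMr// exprn_gt0//; lra.
  have h4 : k * S * (2 * t ^+ 2) <= t ^+ 2 by have := sqr_ge0 t; nra.
  rewrite -ltr_sqr ?nnegrE ?(ltW c0)//.
  apply: lt_le_trans h3; lra.
rewrite chord_infty => h; exfalso; move: h; apply/negP; rewrite -leNgt.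
rewrite /k ge_min; apply/orP; left.
rewrite ler_pdivlMr ?ltr_pwDl ?sqr_ge0// mulrAC ler_pdivrMr; last by lra.
by rewrite /S; have := sqr_ge0 (normc z); lra.
Qed.

Definition sphere_inv x : Chat :=
  match x with
  | Some z => if z == 0 then None else Some z^-1
  | None => Some 0
  end.

Lemma sphere_invK : involutive sphere_inv.
Proof.
by case=> [z|] /=; rewrite ?eqxx//; case: eqVneq => [->|z0]//=;
  rewrite invr_eq0 (negbTE z0) invrK.
Qed.

(** On the unit sphere, 1/z is the half-turn about the first coordinate axis; this is why it is an
    isometry. *)
Lemma stereo_inv x :
  stereo (sphere_inv x) =
  ((stereo x).1.1, - (stereo x).1.2, - (stereo x).2).
Proof.
case: x => [z|] /=; last first.
  by rewrite expr0n/= addr0; congr (_, _, _); field.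
case: eqVneq => [->|z0] /=.
  by rewrite expr0n/= addr0; congr (_, _, _); field.
case: z z0 => [a b] z0 /=.
have s0 : a ^+ 2 + b ^+ 2 != 0.
  apply: contra z0; rewrite paddr_eq0 ?sqr_ge0// !sqrf_eq0.
  by move=> /andP[/eqP-> /eqP->].
have s1 : a ^+ 2 + b ^+ 2 + 1 != 0.
  by rewrite gt_eqF// ltr_wpDl// addr_ge0// sqr_ge0.
have s2 : (a / (a ^+ 2 + b ^+ 2)) ^+ 2 + (- (b / (a ^+ 2 + b ^+ 2))) ^+ 2 =
  (a ^+ 2 + b ^+ 2)^-1 by field.
rewrite /= s2.
have s3 : (a ^+ 2 + b ^+ 2)^-1 + 1 = (a ^+ 2 + b ^+ 2 + 1) / (a ^+ 2 + b ^+ 2).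
  by field.
by rewrite s3; congr (_, _, _); field; rewrite s0 s1.
Qed.

Lemma sphere_inv_isom x y :
  spherical_dist (sphere_inv x) (sphere_inv y) = spherical_dist x y.
Proof. by rewrite /spherical_dist !stereo_inv /dot3/= !mulrNN. Qed.

Lemma sphere_inv_continuous : continuous sphere_inv.
Proof.
move=> x V /nbhs_ballP[e /= e0 he]; apply/nbhs_ballP; exists e => // y.
by rewrite ball_sphereE -sphere_inv_isom => h; apply: he; rewrite ball_sphereE.
Qed.

Lemma nbhs_sphere_inv x (V : set Chat) :
  nbhs (sphere_inv x) V -> nbhs x (sphere_inv @^-1` V).
Proof. exact: sphere_inv_continuous. Qed.

End Sphere.

Arguments sphere_inv {R} x.

(** * Monomials as holomorphic maps of the sphere *)

Section Monomials.
Variable R : realType.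
Local Notation Chat := (riemann_sphere R).
Implicit Types (x y : Chat) (z w b : R[i]) (e : nat).

(** Conjugation by 1/z keeps the degree and inverts the coefficient, so that questions at infinity
    become questions at 0. *)
Lemma sphere_inv_monomial b e x : b != 0 -> (0 < e)%N ->
  sphere_inv (monomial b e x) = monomial b^-1 e (sphere_inv x).
Proof.
move=> b0 e0; case: x => [z|] /=; last by rewrite expr0n eqn0Ngt e0 mulr0.
rewrite mulf_eq0 (negbTE b0) expf_eq0 e0/=; case: eqVneq => // z0.
by rewrite /= invfM exprVn.
Qed.

Lemma monomial_comp b1 e1 b2 e2 :
  monomial b2 e2 \o monomial b1 e1 =
  monomial (b2 * b1 ^+ e2) (e1 * e2) :> (Chat -> Chat).
Proof. by apply/funext => -[z|] //=; rewrite exprMn mulrA exprM. Qed.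

Lemma derivable_cpow b e (z : R[i]^o) :
  derivable (fun t : R[i]^o => b * t ^+ e : R[i]^o) z 1.
Proof.
apply: (@derivableM _ _ (cst b) (fun t : R[i]^o => t ^+ e)).
  exact: derivable_cst.
have := @derivableX _ _ id e _ _ (@derivable_id _ _ z 1).
by rewrite exprfctE.
Qed.

Lemma derivable_cpowV b e (z : R[i]^o) : z != 0 ->
  derivable (fun t : R[i]^o => b * t^-1 ^+ e : R[i]^o) z 1.
Proof.
move=> z0.
apply: (@derivableM _ _ (cst b) (fun t : R[i]^o => t^-1 ^+ e)).
  exact: derivable_cst.
have := @derivableX _ _ _ e _ _ (@derivableV _ _ id z 1 z0 (@derivable_id _ _ _ _)).
by rewrite exprfctE.
Qed.

Lemma nbhs_complex z (V : set R[i]) : nbhs (z : R[i]^o) V ->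
  exists2 c : R, 0 < c & forall w, normc (w - z) < c -> V w.
Proof.
(* Radii of balls in [R[i]] are themselves complex; positivity forces the imaginary part [c'] to
   vanish and the real part [c] to be positive. *)
move=> /nbhs_ballP[[c c'] /=]; rewrite ltcE/= => /andP[/eqP c'0 c0] hc.
exists c => // w hw; apply: hc; rewrite -ball_normE/= distrC.
by rewrite normc_def ltcE/= c'0 eqxx/=; case: (w - z) hw.
Qed.

Lemma monomial_continuous_fin b e z :
  {for (Some z : Chat), continuous (monomial b e)}.
Proof.
move=> V /nbhs_Some[c c0 hc].
have cont : {for (z : R[i]^o),
    continuous (fun t : R[i]^o => b * t ^+ e : R[i]^o)}.
  by apply/differentiable_continuous/derivable1_diffP; exact: derivable_cpow.
have : nbhs (b * z ^+ e : R[i]^o) [set w | normc (w - b * z ^+ e) < c].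
  apply/nbhs_ballP; exists (c%:C)%C => /=; first by rewrite ltcR.
  move=> w; rewrite -ball_normE/= distrC normc_def ltcR.
  by case: (w - _).
move=> /cont /nbhs_complex[k k0 hk]; apply/nbhs_Some; exists k => // w /hk h.
exact: hc.
Qed.

Lemma monomial_continuous b e : b != 0 -> (0 < e)%N ->
  continuous (monomial b e : Chat -> Chat).
Proof.
move=> b0 e0 [z|]; first exact: monomial_continuous_fin.
have -> : monomial b e =
    sphere_inv \o (monomial b^-1 e \o sphere_inv) :> (Chat -> Chat).
  apply/funext => x /=.
  by rewrite -sphere_inv_monomial ?sphere_invK.
apply: continuous_comp; last exact: sphere_inv_continuous.
apply: continuous_comp; first exact: sphere_inv_continuous.
exact: monomial_continuous_fin.
Qed.

(** In the four pairs of charts the map reads b^-1 z^e, b z^-e, b^-1 z^-e and b z^e, in the order of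
    the cases below. In the two mixed pairs the chart domains exclude the pole. *)
Lemma monomial_holomorphic b e U : b != 0 -> (0 < e)%N ->
  holomorphic_on U (monomial b e : Chat -> Chat).
Proof.
move=> b0 e0 x _; split; first exact: monomial_continuous.
case=> -[] xb xc.
- have -> : (fun z : R[i]^o =>
      chart true (monomial b e (chart_inv true z)) : R[i]^o) =
      (fun z => b^-1 * z ^+ e).
    apply/funext => z; rewrite /chart_inv; case: eqVneq => [->|z0] /=.
      by rewrite expr0n eqn0Ngt e0 mulr0.
    by rewrite invfM exprVn invrK.
  exact: derivable_cpow.
- case: x xb xc => [z|] //= xb xc.
  have z0 : z^-1 != 0.
    by rewrite invr_eq0; apply/eqP => z0; apply: xb; rewrite z0.
  apply: near_eq_derivable (@derivable_cpowV b e _ z0).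
  have : \forall t \near (z^-1 : R[i]^o), t != 0.
    apply/nbhs_ballP; exists `|z^-1| => /=; first by rewrite normr_gt0.
    by move=> t; rewrite -ball_normE/=; apply: contraTneq => ->; rewrite subr0 ltxx.
  by apply: filterS => t t0; rewrite (negbTE t0).
- case: x xb xc => [z|] //= _ xc.
  have z0 : z != 0.
    apply/eqP => z0; apply: xc.
    by rewrite z0 expr0n eqn0Ngt e0 mulr0.
  have -> : (fun z : R[i]^o => (b * z ^+ e)^-1 : R[i]^o) =
      (fun z => b^-1 * z^-1 ^+ e).
    by apply/funext => t; rewrite invfM exprVn.
  exact: derivable_cpowV.
- case: x xb xc => [z|] //= _ _; exact: derivable_cpow.
Qed.

Lemma cst_holomorphic U y : holomorphic_on U (cst y : Chat -> Chat).
Proof.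
move=> x _; split; first exact: cst_continuous.
by move=> b c _ _; exact: derivable_cst.
Qed.

End Monomials.

(** * Subsequences, uniform convergence and a criterion for normality *)

Lemma subsequence_of_frequent (P : nat -> Prop) :
  (forall K, exists2 k, (K <= k)%N & P k) ->
  exists phi : nat -> nat, {homo phi : m n / (m < n)%N} /\ forall i, P (phi i).
Proof.
move=> /(_ _)/cid2-/all_sig2 => -[] // f fK fP.
pose phi := fix F n := if n is m.+1 then f (F m).+1 else f 0%N.
exists phi; split; last by case=> [|n]; exact: fP.
by apply: (homo_ltn ltn_trans) => n; exact: fK.
Qed.

Lemma homo_ltn_geq (phi : nat -> nat) :
  {homo phi : m n / (m < n)%N} -> forall n, (n <= phi n)%N.
Proof. by move=> h; elim=> // n IH; apply: leq_ltn_trans IH (h _ _ _). Qed.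

Section UniformConvergence.
Variable R : realType.
Local Notation Chat := (riemann_sphere R).
Implicit Types (u : nat -> Chat -> Chat) (g : Chat -> Chat) (V : set Chat).

Lemma uniform_cvg_dist u g V :
  {uniform V, u @ \oo --> g} <->
  forall e : R, 0 < e -> exists K, forall k, (K <= k)%N ->
    forall y, V y -> spherical_dist (g y) (u k y) < e.
Proof.
split=> [ug e e0|h P /uniform_nbhs[E [entE EP]]].
  have : nbhs (g : {uniform` V -> Chat})
      [set h | forall y, V y -> ball (g y) e (h y)].
    apply/uniform_nbhs; exists [set xy | ball xy.1 e xy.2]; split => //.
    by rewrite -entourage_ballE; exists e.
  move=> /ug[K _ hK]; exists K => k /hK /= hk y /hk.
  by rewrite ball_sphereE.
move: entE; rewrite -entourage_ballE => -[e /= e0 eE].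
have [K hK] := h _ e0; exists K => // k /= Kk; apply: EP => y Vy; apply: eE => /=.
by rewrite ball_sphereE; exact: hK.
Qed.

(** A sequence in the family is [G (m k)] for some indices [m k]. If one index recurs infinitely
    often, a constant subsequence converges to that [G n]. Otherwise the indices tend to infinity,
    one of [P1], [P2] holds infinitely often, and the corresponding subsequence tends to the
    constant [y1] or [y2]. *)
Lemma normal_on_of_dichotomy (G : nat -> Chat -> Chat) (U : set Chat)
    (y1 y2 : Chat) (P1 P2 : nat -> Prop) (N : nat) :
  open U ->
  (forall n, (1 <= n)%N -> holomorphic_on U (G n)) ->
  (forall n, (N <= n)%N -> P1 n \/ P2 n) ->
  (forall e : R, 0 < e -> exists n0, forall n, (n0 <= n)%N -> P1 n ->
     forall y, U y -> spherical_dist y1 (G n y) < e) ->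
  (forall e : R, 0 < e -> exists n0, forall n, (n0 <= n)%N -> P2 n ->
     forall y, U y -> spherical_dist y2 (G n y) < e) ->
  normal_on [set G n | n in [set n | (1 <= n)%N]] U.
Proof.
move=> oU holG P12 cvg1 cvg2 u uG.
have {uG}[m m1 mu] : {m : nat -> nat | forall k, (1 <= m k)%N &
    forall k, G (m k) = u k}.
  apply: (@all_sig2 _ (fun=> nat) (fun k n => (1 <= n)%N)
    (fun k n => G n = u k)) => k.
  by apply: cid2; have [n n1 <-] := uG k; exists n.
have cvgU v g : (forall e : R, 0 < e -> exists K, forall k, (K <= k)%N ->
    forall y, U y -> spherical_dist (g y) (v k y) < e) ->
    cvg_locally_uniformly U v g.
  move=> h x Ux; exists U; first exact: open_nbhs_nbhs.
  exact/uniform_cvg_dist.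
have [[n nfreq]|/forallNP nfin] :=
    pselect (exists n, forall K, exists2 k, (K <= k)%N & m k = n).
  have [phi [phi_homo mphi]] := subsequence_of_frequent nfreq.
  exists phi; split => //; exists (G n); split.
    by apply: holG; rewrite -(mphi 0%N).
  apply: cvgU => e e0; exists 0%N => k _ y _ /=.
  by rewrite -mu mphi spherical_distxx.
(* Each value is taken only finitely often, so [m] tends to infinity; the induction discards one
   value at a time. *)
have minf B : exists K, forall k, (K <= k)%N -> (B <= m k)%N.
  elim: B => [|B [K hK]]; first by exists 0%N.
  have /existsNP[L hL] := nfin B.
  exists (maxn K L) => k; rewrite geq_max => /andP[/hK Bk Lk].
  rewrite ltn_neqAle Bk andbT; apply/eqP => Bm; apply: hL.
  by exists k.
have limit y (P : nat -> Prop) :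
    (forall e : R, 0 < e -> exists n0, forall n, (n0 <= n)%N -> P n ->
     forall z, U z -> spherical_dist y (G n z) < e) ->
    (forall K, exists2 k, (K <= k)%N & P (m k)) ->
    exists phi : nat -> nat, {homo phi : m n / (m < n)%N} /\
    exists g : Chat -> Chat,
      holomorphic_on U g /\ cvg_locally_uniformly U (u \o phi) g.
  move=> cvgP /subsequence_of_frequent[phi [phi_homo Pphi]].
  exists phi; split => //; exists (cst y); split; first exact: cst_holomorphic.
  apply: cvgU => e e0; have [n0 hn0] := cvgP e e0; have [K hK] := minf n0.
  exists K => k Kk z Uz /=; rewrite -mu; apply: hn0 => //.
  by apply: hK; apply: leq_trans Kk (homo_ltn_geq phi_homo k).
have [/(limit y1 _ cvg1)//|/existsNP[K hK]] :=
    pselect (forall K, exists2 k, (K <= k)%N & P1 (m k)).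
apply: (limit y2 _ cvg2) => L; have [K' hK'] := minf N.
exists (maxn L (maxn K K')); first exact: leq_maxl.
set k := maxn _ _.
have : (N <= m k)%N by apply: hK'; rewrite /k !leq_max leqnn !orbT.
case/P12 => // P1k; exfalso; apply: hK; exists k => //.
by rewrite /k !leq_max leqnn !orbT.
Qed.

End UniformConvergence.

(** * Points well inside or well outside a circle, and their images *)

Section Radii.
Variable R : realType.
Local Notation Chat := (riemann_sphere R).
Implicit Types (x y : Chat) (z w b : R[i]) (q M r : R).

Definition circle r : set Chat :=
  [set x | if x is Some z then normc z = r else False].

(** The ratio [q] gives geometric decay of (|z| / r)^(e - 1). The separate bound [M] controls the
    remaining factor |z| uniformly in [r], since the radii may be unbounded. *)
Definition below q M r : set Chat :=
  [set x | if x is Some z then normc z <= q * r /\ normc z <= M else False].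

Definition above q M r : set Chat := sphere_inv @^-1` below q M r^-1.

Lemma circle_inv r x : 0 < r -> circle r x -> circle r^-1 (sphere_inv x).
Proof.
move=> r0; case: x => //= z zr; have : z != 0 by rewrite -normc_gt0 zr.
by move=> /negbTE ->; rewrite /circle/= normcV zr.
Qed.

Lemma geometric_small q M (c : R) : 0 <= q < 1 -> 0 < c ->
  exists n0, forall n, (n0 <= n)%N -> q ^+ n * M < c.
Proof.
move=> /andP[q0 q1] c0.
have /cvgrPdist_lt/(_ c c0)[n0 _ h] : geometric M q x @[x --> \oo] --> 0.
  by apply: cvg_geometric; rewrite ger0_norm.
exists n0 => n /h /=; rewrite sub0r normrN mulrC.
exact/le_lt_trans/ler_norm.
Qed.

(* If [|b| r ^ (e - 1) = 1], then [|b z ^ e| = |z| (|z| / r) ^ (e - 1)]. *)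
Lemma monomial_below q M (eps : R) : 0 <= q < 1 -> 0 < eps ->
  exists e0, forall e b r x, (e0 < e)%N -> 0 < r ->
    normc b * r ^+ e.-1 = 1 -> below q M r x ->
    spherical_dist (Some 0) (monomial b e x) < eps.
Proof.
move=> q01 eps0.
have /nbhs_Some[c c0 hc] := nbhsx_ballx (Some 0 : Chat) eps eps0.
have [e0 he0] := geometric_small M q01 c0.
exists e0 => -[//|e] b r [z|]//= e0e r0 br [zq zM].
rewrite -ball_sphereE; apply: hc; rewrite subr0; apply: le_lt_trans (he0 e e0e).
rewrite normcM normcX exprSr mulrA; apply: ler_pM; rewrite ?normc_ge0//.
  by rewrite mulr_ge0 ?exprn_ge0 ?normc_ge0.
rewrite -[leRHS]mulr1 -br mulrCA -exprMn ler_wpM2l ?normc_ge0//.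
by rewrite lerXn2r ?nnegrE ?normc_ge0// mulr_ge0 ?(ltW r0)//; case/andP: q01.
Qed.

(** This is [monomial_below] seen through 1/z: the normalisation is preserved when [b] and [r] are
    both inverted. *)
Lemma monomial_above q M (eps : R) : 0 <= q < 1 -> 0 < eps ->
  exists e0, forall e b r x, (e0 < e)%N -> 0 < r ->
    normc b * r ^+ e.-1 = 1 -> above q M r x ->
    spherical_dist None (monomial b e x) < eps.
Proof.
move=> q01 eps0; have [e0 he0] := monomial_below M q01 eps0.
exists e0 => e b r x e0e r0 br xa; rewrite -sphere_inv_isom.
have e_gt0 : (0 < e)%N by exact: leq_ltn_trans e0e.
have b0 : b != 0.
  by apply/eqP => b0; move/eqP: br; rewrite b0 normc0 mul0r eq_sym oner_eq0.
rewrite sphere_inv_monomial//; apply: he0 xa; rewrite ?invr_gt0//.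
by rewrite normcV exprVn -invfM br invr1.
Qed.

(** If [V] contains the disc of radius c about z, a circle missing [V] has radius at least |z| + c
    or at most |z| - c. The disc of radius c/2 then lies inside or outside it with a gap, and [q]
    and [M] do not depend on [r]. *)
Lemma circle_gap_fin z (V : set Chat) : nbhs (Some z : Chat) V ->
  exists (U : set Chat) q M, [/\ nbhs (Some z : Chat) U, 0 <= q < 1 &
    forall r, 0 < r -> (forall y, V y -> ~ circle r y) ->
      U `<=` below q M r \/ U `<=` above q M r].
Proof.
move=> /nbhs_Some[c c0 hc]; set m := normc z; have m0 : 0 <= m := normc_ge0 z.
have mc0 : 0 < m + c by rewrite ltr_wpDl.
exists [set x | if x is Some w then normc (w - z) < c / 2 else False].
(* This ratio also dominates the outer one (m - c) / (m - c/2), because m^2 - c^2 <= m^2 - c^2/4.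
   The bound 2/c is for 1/|w|: in the outer case m >= c + r, hence |w| > c/2. *)
exists ((m + c / 2) / (m + c)), (Num.max (m + c) (2 / c)); split.
- by apply/nbhs_Some; exists (c / 2) => //; rewrite divr_gt0.
- apply/andP; split; first by rewrite divr_ge0//; lra.
  by rewrite ltr_pdivrMr//; lra.
move=> r r0 Vr.
have [rm|mr] := leP (m + c) r.
  left => -[w|]//= wz; have := normcB_le z w; rewrite -/m => wm.
  split; last by rewrite le_max; apply/orP; left; lra.
  rewrite mulrAC ler_pdivlMr//; have := normc_ge0 w; nra.
(* Otherwise |r - m| < c and [V] contains a point of modulus [r]: the radial projection of z to that
   circle, or the real number [r] when z = 0. *)
have {Vr}rm : r <= m - c.
  rewrite leNgt; apply/negP => rm.
  have [z0|z0] := eqVneq z 0.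
    have rm0 : m = 0 by rewrite /m z0 normc0.
    apply: (Vr (Some (r%:C)%C)); last exact: normc_real (ltW r0).
    by apply: hc; rewrite z0 subr0 normc_real ?ltW//; lra.
  have m_gt0 : 0 < m by rewrite normc_gt0.
  apply: (Vr (Some ((r / m)%:C%C * z))).
    apply: hc; rewrite -[X in _ - X]mul1r -mulrBl normcM -/m.
    have -> : ((r / m)%:C - 1)%C = ((r - m) / m)%:C%C :> R[i].
      by rewrite mulrBl divff ?gt_eqF// rmorphB.
    rewrite /= expr0n/= addr0 sqrtr_sqr normrM normfV (ger0_norm m0).
    by rewrite divfK ?gt_eqF// ltr_norml; apply/andP; split; lra.
  by rewrite /= normcM normc_real ?divr_ge0 ?ltW// divfK ?gt_eqF.
right => -[w|]//= wz; rewrite /above/=.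
have := normcB_le w z; rewrite normc_distC -/m => wm.
have w0 : 0 < normc w by lra.
have wn0 : w != 0 by rewrite -normc_gt0.
rewrite (negbTE wn0) /= normcV; split.
  rewrite ler_pdivlMr// mulrC ler_pdivrMr// mulrAC ler_pdivlMr//.
  by have := sqr_ge0 c; nra.
rewrite le_max; apply/orP; right.
by rewrite -[leRHS]invrK lef_pV2 ?posrE ?invr_gt0 ?divr_gt0// invf_div; lra.
Qed.

(** Infinity is handled by the finite case at 0; the inversion exchanges [below] and [above]. *)
Lemma circle_gap x (V : set Chat) : nbhs x V ->
  exists (U : set Chat) q M, [/\ nbhs x U, 0 <= q < 1 &
    forall r, 0 < r -> (forall y, V y -> ~ circle r y) ->
      U `<=` below q M r \/ U `<=` above q M r].
Proof.
case: x => [z|]; first exact: circle_gap_fin.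
rewrite -{1}(sphere_invK None) => /nbhs_sphere_inv/circle_gap_fin.
move=> [U [q [M [nU q01 hU]]]].
exists (sphere_inv @^-1` U), q, M; split => // [|r r0 Vr].
  exact: (@nbhs_sphere_inv _ None).
have /hU : 0 < r^-1 by rewrite invr_gt0.
case.
- move=> y /= Vy cy; apply: (Vr _ Vy).
  by rewrite -(invrK r); apply: circle_inv; rewrite ?invr_gt0.
- by move=> h; right => y /= /h.
- by move=> h; left => y /= /h; rewrite /above/= sphere_invK invrK.
Qed.

End Radii.

(** * Points of smaller modulus than a given point of the sphere *)

Section ComparingModuli.
Variable R : realType.
Local Notation Chat := (riemann_sphere R).
Implicit Types (x y : Chat) (z w b : R[i]) (q M r : R).

(* The exception [w = 0] makes 0 lower than itself, so that every point is a
   limit of points lower than it, and of points whose inverses are lower. *)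
Definition lower (w x : Chat) : Prop :=
  match w, x with
  | None, _ => False
  | Some _, None => True
  | Some w, Some z => w = 0 \/ normc w < normc z
  end.

(** Circles meeting a small neighbourhood of [x] have radius close to |x|, so |w| / r stays away
    from 1. *)
Lemma lower_below (w x : Chat) : lower w x ->
  exists q M, 0 <= q < 1 /\ exists2 V : set Chat, nbhs x V &
    forall r, 0 < r -> V `&` circle r !=set0 -> below q M r w.
Proof.
case: w => [w|]//; have [->|w0] := eqVneq w 0.
  exists 0, 0; rewrite lexx ltr01; split=> //; exists setT; first exact: filterT.
  by move=> r r0 _; split; rewrite normc0 ?mul0r.
have nw0 : 0 < normc w by rewrite normc_gt0.
case: x => [z /= [/eqP|wz]|_]; first by rewrite (negbTE w0).
  (* The neighbourhood has radius half the gap |z| - |w|, so every circle meeting it has radius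
     above the mean of |w| and |z|; [q] is |w| over that mean. *)
  exists (2 * normc w / (normc w + normc z)), (normc w); split.
    apply/andP; split; first by rewrite divr_ge0//; lra.
    by rewrite ltr_pdivrMr; lra.
  exists [set x | if x is Some y then
    normc (y - z) < (normc z - normc w) / 2 else False].
    by apply/nbhs_Some; exists ((normc z - normc w) / 2) => //; lra.
  move=> r r0 [[y|] []]//= yz yr; split=> //.
  have := normcB_le y z; rewrite normc_distC yr => zr.
  by rewrite mulrAC ler_pdivlMr; nra.
exists (1 / 2), (normc w); split; first by lra.
exists (sphere_inv @^-1` [set x | if x is Some y then
    normc y < (2 * normc w)^-1 else False]).
  apply: (@nbhs_sphere_inv _ None); apply/nbhs_Some.
  exists (2 * normc w)^-1; first by rewrite invr_gt0; lra.
  by move=> y; rewrite subr0.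
move=> r r0 [[y|] []]//=; case: eqVneq => // y0.
rewrite normcV => + yr; rewrite yr ltf_pV2 ?posrE//; last by lra.
by move=> wr; split => //; lra.
Qed.

Lemma nbhs_lower x (U : set Chat) : nbhs x U -> exists2 w, U w & lower w x.
Proof.
case: x => [z|]; last first.
  rewrite -{1}(sphere_invK None) => /nbhs_sphere_inv/nbhs_Some[c c0 hc].
  have cn0 : (c / 2)%:C%C != 0 :> R[i].
    by rewrite -normc_gt0 normc_real; lra.
  exists (sphere_inv (Some (c / 2)%:C%C)); last by rewrite /= (negbTE cn0).
  by apply: (hc (c / 2)%:C%C); rewrite subr0 normc_real; lra.
have [->|z0] := eqVneq z 0.
  by move=> /nbhs_singleton U0; exists (Some 0) => //=; left.
have m0 : 0 < normc z by rewrite normc_gt0.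
(* Scaling z by 1 - k moves it by k |z| <= c/2, and k <= 1 keeps the factor nonnegative. *)
move=> /nbhs_Some[c c0 hc]; pose k := Num.min 1 (c / (2 * normc z)).
have k0 : 0 < k by rewrite lt_min ltr01 divr_gt0//; lra.
have k1 : k <= 1 by rewrite ge_min lexx.
have kc : k <= c / (2 * normc z) by rewrite ge_min lexx orbT.
exists (Some ((1 - k)%:C%C * z)).
  apply: hc; have -> : (1 - k)%:C%C * z - z = - (k%:C%C * z).
    by rewrite rmorphB rmorph1; ring.
  rewrite (normcN (_ * _)) normcM normc_real ?(ltW k0)//.
  apply: le_lt_trans (_ : c / 2 < c); last by lra.
  apply: le_trans (ler_wpM2r (ltW m0) kc) _.
  by rewrite invfM mulrA mulfVK ?gt_eqF.
right; rewrite normcM normc_real ?subr_ge0//; nra.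
Qed.

End ComparingModuli.

(** * The Julia set of a family of monomials is the limit set of its circles *)

Section JuliaSet.
Variable R : realType.
Local Notation Chat := (riemann_sphere R).
Variables (B : nat -> R[i]) (E : nat -> nat) (r : nat -> R).
Hypothesis B_neq0 : forall n, (1 <= n)%N -> B n != 0.
Hypothesis E_gt0 : forall n, (1 <= n)%N -> (1 <= E n)%N.
Hypothesis E_infty : forall K, exists N, forall n, (N <= n)%N -> (K <= E n)%N.
Hypothesis r_gt0 : forall n, 0 < r n.
Hypothesis Br : forall n, (1 <= n)%N -> (2 <= E n)%N ->
  normc (B n) * r n ^+ (E n).-1 = 1.

Let G n : Chat -> Chat := monomial (B n) (E n).
Let Fam := [set G n | n in [set n | (1 <= n)%N]].
Let limit_circles : set Chat :=
  \bigcap_(N >= 1) closure (\bigcup_(n >= N) circle (r n)).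

Lemma fatou_of_not_limit_circle (x : Chat) :
  ~ limit_circles x -> fatou_family Fam x.
Proof.
move=> /existsNP[N /not_implyP[/= N1]] /existsNP[V /not_implyP[nV VC]].
have [U [q [M [nU q01 hU]]]] := circle_gap nV.
have [N2 hN2] := E_infty 2.
exists (interior U); last exact: nU.
split; first exact: open_interior.
have sU : interior U `<=` U by exact: interior_subset.
(* The index bound is recorded because [Br] applies only to positive [n] with degree at least 2. *)
pose good (S : R -> set Chat) n := (maxn N N2 <= n)%N /\ U `<=` S (r n).
apply: (@normal_on_of_dichotomy _ _ _ (Some 0) None
    (good (below q M)) (good (above q M)) (maxn N N2)).
- exact: open_interior.
- by move=> n n1; apply: monomial_holomorphic; [exact: B_neq0|exact: E_gt0].
- move=> n Nn; suff [h|h] : U `<=` below q M (r n) \/ U `<=` above q M (r n).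
  + by left.
  + by right.
  apply: hU => // y Vy yr; apply: VC; exists y; split => //.
  by exists n => //=; apply: leq_trans Nn; exact: leq_maxl.
- move=> e e0; have [n1 h1] := monomial_below M q01 e0.
  have [n2 h2] := E_infty n1.+1.
  exists n2 => n /h2 n1E [Nn Un] y /sU Uy; apply: h1 (Un _ Uy) => //.
  move: Nn; rewrite geq_max => /andP[Nn N2n].
  by apply: Br; [exact: leq_trans Nn|exact: hN2].
- move=> e e0; have [n1 h1] := monomial_above M q01 e0.
  have [n2 h2] := E_infty n1.+1.
  exists n2 => n /h2 n1E [Nn Un] y /sU Uy; apply: h1 (Un _ Uy) => //.
  move: Nn; rewrite geq_max => /andP[Nn N2n].
  by apply: Br; [exact: leq_trans Nn|exact: hN2].
Qed.

Lemma limit_circle_subsequence (x : Chat) : limit_circles x ->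
  exists m : nat -> nat, (forall k, (k < m k)%N) /\
    forall V, nbhs x V -> exists K, forall k, (K <= k)%N ->
      V `&` circle (r (m k)) !=set0.
Proof.
move=> xC.
have /(_ _)/cid2-/all_sig2[m km hm] k : exists2 n, (k < n)%N &
    ball x k.+1%:R^-1 `&` circle (r n) !=set0.
  have := xC k.+1 isT (ball x k.+1%:R^-1).
  move=> [|y [[n /= kn yr] xy]]; first by apply: nbhsx_ballx; rewrite invr_gt0.
  by exists n => //; exists y.
exists m; split => // V /nbhs_ballP[e /= e0 eV].
have [K _ hK] := near_infty_natSinv_lt (PosNum e0).
exists K => k /hK /= ke; have [y [xy yr]] := hm k.
by exists y; split => //; apply: eV; apply: le_ball xy; exact: ltW.
Qed.

Lemma not_fatou_of_limit_circle (x : Chat) :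
  limit_circles x -> ~ fatou_family Fam x.
Proof.
move=> /limit_circle_subsequence[m [km mV]] [U [oU nU] Ux].
have [k|phi [phi_homo [g [hg cg]]]] := nU (fun k => G (m k)).
  by exists (m k) => //=; exact: leq_trans (km k).
have mphi k : (k < m (phi k))%N.
  by apply: leq_ltn_trans (km _); exact: homo_ltn_geq.
have limit y w : U w -> (forall e : R, 0 < e -> exists K, forall k, (K <= k)%N ->
    spherical_dist y (G (m k) w) < e) -> g w = y.
  move=> /cg[V /nbhs_singleton Vw /uniform_cvg_dist cgV] cy.
  apply/esym/spherical_dist_positivity/eqP; rewrite eq_le acos_ge0 ?stereo_bound//.
  rewrite andbT; apply/ler_addgt0Pl => e e0; rewrite addr0.
  have e20 : 0 < e / 2 by rewrite divr_gt0.
  have [K1 h1] := cgV _ e20; have [K2 h2] := cy _ e20.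
  have /h1/(_ w Vw) := leq_maxl K1 K2; set k := maxn _ _; move=> {}h1.
  have /h2 {}h2 : (K2 <= phi k)%N.
    by apply: leq_trans (homo_ltn_geq phi_homo k); exact: leq_maxr.
  apply: le_trans (spherical_dist_triangle (G (m (phi k)) w) _ _) _.
  by rewrite [leRHS]splitr (spherical_dist_sym _ (g w)) lerD// ltW.
have tail V : nbhs x V -> forall n0, exists K, forall k, (K <= k)%N ->
    [/\ (n0 < E (m k))%N, (2 <= E (m k))%N & V `&` circle (r (m k)) !=set0].
  move=> /mV[K1 h1] n0; have [K2 h2] := E_infty n0.+2.
  exists (maxn K1 K2) => k; rewrite geq_max => /andP[/h1 ? K2k].
  have /h2 h : (K2 <= m k)%N by apply: leq_trans K2k (ltnW (km k)).
  by split => //; apply: leq_trans h.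
have g_low w : U w -> lower w x -> g w = Some 0.
  move=> Uw /lower_below[q [M [q01 [V nV hV]]]]; apply: limit => // e e0.
  have [n0 h0] := monomial_below M q01 e0; have [K hK] := tail V nV n0.
  exists K => k /hK[n0E E2 VC]; apply: h0 (hV _ _ VC) => //.
  by apply: Br => //; exact: leq_trans (km k).
have g_high w : U w -> lower (sphere_inv w) (sphere_inv x) -> g w = None.
  move=> Uw /lower_below[q [M [q01 [V nV hV]]]]; apply: limit => // e e0.
  have [n0 h0] := monomial_above M q01 e0.
  have [K hK] := tail _ (nbhs_sphere_inv nV) n0.
  exists K => k /hK[n0E E2 [y [Vy yr]]]; apply: h0 => //.
    by apply: Br => //; exact: leq_trans (km k).
  apply: hV; first by rewrite invr_gt0.
  by exists (sphere_inv y); split => //; exact: circle_inv.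
(* Continuity of [g] at [x]: a value taken arbitrarily close to [x] is the value at [x]. Applied to
   0 and to infinity, it yields the contradiction. *)
have gx y : (forall V, nbhs x V -> exists2 w, V w & g w = y) -> g x = y.
  move=> gy; apply: contrapT => /eqP gxy.
  have d_gt0 : 0 < spherical_dist (g x) y.
    rewrite lt_def acos_ge0 ?stereo_bound// andbT; apply: contra gxy => /eqP.
    by move=> /spherical_dist_positivity ->.
  have [w /= wd gw] := gy _ ((hg x Ux).1 _ (nbhsx_ballx (g x) _ d_gt0)).
  by move: wd; rewrite ball_sphereE gw ltxx.
have nUx : nbhs x U by exact: open_nbhs_nbhs.
have : g x = Some 0.
  apply: gx => V nV; have [w [Vw Uw] wx] := nbhs_lower (filterI nV nUx).
  by exists w => //; exact: g_low.
suff -> : g x = None by [].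
(* Points higher than [x] are the inverses of points lower than 1/x. *)
apply: gx => V nV; have := @nbhs_sphere_inv _ (sphere_inv x) (V `&` U).
rewrite sphere_invK => /(_ (filterI nV nUx))/nbhs_lower[w [Vw Uw] wx].
by exists (sphere_inv w) => //; apply: g_high => //; rewrite sphere_invK.
Qed.

Lemma julia_monomial_family : ~` fatou_family Fam = limit_circles.
Proof.
apply/seteqP; split=> x; last exact: not_fatou_of_limit_circle.
by move=> nF; apply: contrapT => /fatou_of_not_limit_circle.
Qed.

End JuliaSet.

(** * Kuratowski limits superior as intersections of closures *)

(** The autonomous Julia sets are obtained as closures of circles, and only once the degree is at
    least 2; neither the closures nor the first terms affect the limit set. *)
Lemma bigcap_closure_closure (T : topologicalType) (A C : nat -> set T) N0 :
  (forall n, (N0 <= n)%N -> A n = closure (C n)) ->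
  \bigcap_(N >= 1) closure (\bigcup_(n >= N) A n) =
  \bigcap_(N >= 1) closure (\bigcup_(n >= N) C n).
Proof.
move=> AC; apply/seteqP; split => x xh N N1 V nV;
  have NN : (1 <= maxn N N0)%N by rewrite leq_max N1.
  (* The point [y] is taken in the interior of [V], so that [V] is a neighbourhood of [y] and meets
     [C n]. *)
  have [y [[n /= Nn Any] Vy]] := xh _ NN _ (nbhs_interior nV).
  move: Nn; rewrite geq_max => /andP[Nn N0n].
  move: Any; rewrite AC// => /(_ _ Vy)[z [Cz Vz]].
  by exists z; split => //; exists n.
have [y [[n /= Nn Cny] Vy]] := xh _ NN _ nV.
move: Nn; rewrite geq_max => /andP[Nn N0n].
by exists y; split => //; exists n => //; rewrite AC//; exact: subset_closure.
Qed.

(** The lower limit is the supremum of the infima over tails. These are nonnegative, so it vanishes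
    exactly when each of them does, that is, when [x] is adherent to the union of every tail. *)
Lemma kuratowski_limsup_bigcap (R : realType) (X : metricType R)
    (E : nat -> set X) :
  kuratowski_limsup E = \bigcap_(N >= 1) closure (\bigcup_(n >= N) E n).
Proof.
have lim0 x : kuratowski_limsup E x <->
    forall N, einfs (fun n => edist_inf (E n) x) N = 0%E.
  rewrite /kuratowski_limsup/= limn_einf_lim.
  rewrite (cvg_lim _ (@cvg_einfs_sup _ _))//.
  have ge0 N : (0 <= einfs (fun n => edist_inf (E n) x) N)%E.
    by apply: le_ereal_inf_tmp => _ [n _ <-]; exact: edist_inf_ge0.
  split=> [s0 N|h].
    apply/eqP; rewrite eq_le ge0 andbT -s0; apply: ereal_sup_ubound.
    by exists N.
  apply/eqP; rewrite eq_le; apply/andP; split.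
    by apply: ge_ereal_sup => _ [N _ <-]; rewrite h.
  by rewrite -(h 0%N); apply: ereal_sup_ubound; exists 0%N.
apply/seteqP; split => x.
  move=> /lim0 h N _ V /nbhs_ballP[e /= e0 eV].
  have : (einfs (fun n => edist_inf (E n) x) N < e%:E)%E by rewrite h lte_fin.
  move=> /ereal_inf_lt[_ [n /= Nn <-]] /ereal_inf_lt[_ [y Ey <-]].
  move=> /edist_lt_ball/= /eV Vy; exists y; split => //.
  by exists n.
move=> h; apply/lim0 => N; apply/eqP; rewrite eq_le; apply/andP; split; last first.
  by apply: le_ereal_inf_tmp => _ [n _ <-]; exact: edist_inf_ge0.
apply/lee_addgt0Pr => e e0; rewrite add0e.
(* Tails of the lower limit start at 0 but the intersection starts at 1, hence the shift to
   [N.+1]. *)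
have [y [[n /= Nn Ey] xy]] := h N.+1 isT _ (nbhsx_ballx x e e0).
apply: le_trans (edist_fin e0 (xy : ball (x, y).1 e (x, y).2)).
apply: (@le_trans _ _ (edist_inf (E n) x)).
  by apply: ereal_inf_lbound; exists n => //=; exact: ltnW.
by apply: ereal_inf_lbound; exists y.
Qed.

(** Used for the iterates of one monomial, which all have the same circle. *)
Lemma closure_eventually_cst (T : topologicalType) (C : set T) :
  \bigcap_(N >= 1) closure (\bigcup_(n >= N) C) = closure C.
Proof.
have C_eq N : \bigcup_(n >= N) C = C.
  by apply/seteqP; split=> x; [case|exists N => /=].
apply/seteqP; split=> x; first by move=> /(_ 1%N isT); rewrite C_eq.
by move=> Cx N _; rewrite C_eq.
Qed.

(** * Iterates of a monomial and their common radius *)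

Section MonomialIteration.
Variable R : realType.
Local Notation Chat := (riemann_sphere R).
Implicit Types (b : R[i]) (e k : nat) (r : R).

(* [z |-> b z ^ e] maps the circle of this radius to itself; the value is
   irrelevant for [e <= 1]. *)
Definition fixed_radius b e : R := normc b `^ (- (e.-1%:R)^-1).

Lemma fixed_radius_gt0 b e : b != 0 -> 0 < fixed_radius b e.
Proof. by move=> b0; rewrite powR_gt0// normc_gt0. Qed.

Lemma fixed_radiusP b e : b != 0 -> (2 <= e)%N ->
  normc b * fixed_radius b e ^+ e.-1 = 1.
Proof.
case: e => [|[|e]]// b0 _; have nb : normc b != 0 by rewrite normc_eq0.
rewrite -powR_mulrn ?powR_ge0// -powRrM mulNr mulVf ?pnatr_eq0//.
by rewrite powR_inv1 ?normc_ge0// divff.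
Qed.

Fixpoint iter_coef b e k : R[i] :=
  if k is k'.+1 then b * iter_coef b e k' ^+ e else 1.

Lemma iter_monomial b e k :
  iter k (monomial b e) = monomial (iter_coef b e k) (e ^ k) :> (Chat -> Chat).
Proof.
elim: k => [|k IH]; first by apply/funext => -[z|] //=; rewrite mul1r.
by rewrite /= expnSr -monomial_comp -IH.
Qed.

Lemma iter_coef_neq0 b e k : b != 0 -> iter_coef b e k != 0.
Proof.
by move=> b0; elim: k => [|k IH] /=; rewrite ?oner_eq0 ?mulf_neq0 ?expf_neq0.
Qed.

(** By e^(k+1) - 1 = (e^k - 1) e + (e - 1), the product for k + 1 is the e-th power of the product
    for k times the normalisation of [b]. *)
Lemma normc_iter_coef b e k r : (0 < e)%N -> normc b * r ^+ e.-1 = 1 ->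
  normc (iter_coef b e k) * r ^+ (e ^ k).-1 = 1.
Proof.
move=> e0 br; elim: k => [|k IH]; first by rewrite [iter_coef _ _ _]/= normc1 mulr1.
have -> : (e ^ k.+1).-1 = ((e ^ k).-1 * e + e.-1)%N.
  have : (0 < e ^ k)%N by rewrite expn_gt0 e0.
  by case: (e ^ k)%N (expnSr e k) => // m ->; case: e e0 {br IH} => // e _ _;
    rewrite mulSn addSn/= addnC.
rewrite [iter_coef _ _ _]/= normcM normcX addnC exprD mulrACA br mul1r exprM -exprMn.
by rewrite IH expr1n.
Qed.

End MonomialIteration.

(** * Autonomous Julia sets, compositions of monomials and the conclusion *)

Section MonomialComposition.
Variable R : realType.
Local Notation Chat := (riemann_sphere R).

Lemma julia_aut_monomial (b : R[i]) e : b != 0 -> (2 <= e)%N ->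
  julia_aut (monomial b e) = closure (circle (fixed_radius b e)).
Proof.
move=> b0 e2; have e0 : (0 < e)%N by exact: ltnW.
rewrite /julia_aut -[RHS]closure_eventually_cst.
have -> : (fun k => iter k (monomial b e : Chat -> Chat)) =
    (fun k => monomial (iter_coef b e k) (e ^ k)).
  by apply/funext => k; exact: iter_monomial.
apply: julia_monomial_family.
- by move=> k _; exact: iter_coef_neq0.
- by move=> k _; rewrite expn_gt0 e0.
- move=> K; exists K => k Kk; apply: leq_trans Kk _.
  exact: ltnW (ltn_expl k e2).
- by move=> _; exact: fixed_radius_gt0.
- by move=> k _ _; apply: normc_iter_coef => //; exact: fixed_radiusP.
Qed.

Fixpoint comp_coef (a : nat -> R[i]) (d : nat -> nat) n : R[i] :=
  if n is m.+1 then a m.+1 * comp_coef a d m ^+ d m.+1 else 1.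

Fixpoint comp_degree (d : nat -> nat) n : nat :=
  if n is m.+1 then (comp_degree d m * d m.+1)%N else 1.

Lemma comp_seq_monomial (a : nat -> R[i]) d n :
  comp_seq (fun n => monomial (a n) (d n)) n =
  monomial (comp_coef a d n) (comp_degree d n) :> (Chat -> Chat).
Proof.
elim: n => [|n IH] /=; first by apply/funext => -[z|] //=; rewrite mul1r.
by rewrite IH monomial_comp.
Qed.

Lemma comp_coef_neq0 (a : nat -> R[i]) d n :
  (forall n, (1 <= n)%N -> a n != 0) -> comp_coef a d n != 0.
Proof.
move=> a0; elim: n => [|n IH] /=; first exact: oner_neq0.
by rewrite mulf_neq0 ?a0// expf_neq0.
Qed.

Lemma comp_degree_gt0 d n :
  (forall n, (1 <= n)%N -> (1 <= d n)%N) -> (1 <= comp_degree d n)%N.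
Proof. by move=> d1; elim: n => //= n IH; rewrite muln_gt0 IH d1. Qed.

Lemma leq_comp_degree d m n : (forall n, (1 <= n)%N -> (1 <= d n)%N) ->
  (m <= n)%N -> (comp_degree d m <= comp_degree d n)%N.
Proof.
move=> d1; elim: n => [|n IH]; first by rewrite leqn0 => /eqP ->.
rewrite leq_eqVlt => /predU1P[->//|]; rewrite ltnS => /IH /leq_trans; apply.
by rewrite /= leq_pmulr// d1.
Qed.

Lemma comp_degree_infty d : (forall n, (1 <= n)%N -> (1 <= d n)%N) ->
  (forall N, exists2 n, (N <= n)%N & (2 <= d n)%N) ->
  forall K, exists N, forall n, (N <= n)%N -> (K <= comp_degree d n)%N.
Proof.
move=> d1 dinf; elim=> [|K [N hN]]; first by exists 0%N.
(* Asking for an index from [N.+1] on gives m + 1 with m >= N: the degree is already at least [K] at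
   m, and the factor of at least 2 increases it strictly. *)
have [[//|m] Nm dm] := dinf N.+1.
exists m.+1 => n /(leq_comp_degree d1); apply: leq_trans => /=.
apply: leq_ltn_trans (hN _ Nm) _.
by rewrite -[ltnLHS]muln1 ltn_pmul2l// comp_degree_gt0.
Qed.

End MonomialComposition.

Theorem theorem4p7 (R : realType) (a : nat -> R[i]) (d : nat -> nat)
    (ha : forall n, (1 <= n)%N -> a n != 0)
    (hd : forall n, (1 <= n)%N -> (1 <= d n)%N)
    (hinf : forall N, exists2 n, (N <= n)%N & (2 <= d n)%N) :
  let p := fun n => monomial (a n) (d n) in
  let J := fun n => julia_aut (comp_seq p n) in
  julia p = kuratowski_limsup J /\
  kuratowski_limsup J = \bigcap_(N >= 1) closure (\bigcup_(n >= N) J n).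
Proof.
move=> p J; rewrite kuratowski_limsup_bigcap; split=> //.
pose A := comp_coef a d; pose D := comp_degree d.
have A0 n : A n != 0 by exact: comp_coef_neq0.
have [N0 hN0] := comp_degree_infty hd hinf 2.
(* From [N0] on the composition has degree at least 2, so [julia_aut_monomial] applies; both sides
   then reduce to the limit set of the same circles. *)
rewrite (@bigcap_closure_closure _ J
  (fun n => circle (fixed_radius (A n) (D n))) N0); last first.
  by move=> n /hN0 D2; rewrite /J comp_seq_monomial julia_aut_monomial.
rewrite /julia /Defs.fatou.
have -> : (fun n => comp_seq p n) = fun n => monomial (A n) (D n).
  by apply/funext => n; exact: comp_seq_monomial.
apply: julia_monomial_family.
- by [].
- by move=> n _; exact: comp_degree_gt0.
- exact: comp_degree_infty.
- by move=> n; exact: fixed_radius_gt0.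
- by move=> n _; exact: fixed_radiusP.
Qed.
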